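(* Let $X$ be a Hilbert space. Then $H_\nu(X,B)=\sqrt2$ for all $0\le\nu\le1$.
   Context: $S_X$ is the unit sphere of $X$. For $x,y\in X$, $x\perp_B y$ (Birkhoff orthogonality) means $\|x+\lambda y\|\ge\|x\|$ for all real $\lambda$. For $0\le\nu\le1$, $$H_\nu(X,B)=\sup\left\{\frac{\|x+y\|^{\nu}\|x-y\|^{1-\nu}+\|x+y\|^{1-\nu}\|x-y\|^{\nu}}{2}:\ x,y\in S_X,\ x\perp_B y\right\}.$$ *)

(* Defs.v *)
From HB Require Import structures.
From mathcomp Require Import all_boot all_order all_algebra.
From mathcomp Require Import all_classical all_reals all_analysis.

Set Implicit Arguments.
Unset Strict Implicit.
Unset Printing Implicit Defensive.

Import Order.TTheory GRing.Theory Num.Theory.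
Import numFieldNormedType.Exports.

Local Open Scope classical_set_scope.
Local Open Scope ring_scope.

(* [{dot X for idfun}] is the type of symmetric positive definite R-bilinear
   forms on X; completeness is part of [completeNormedModType]. *)
Definition is_hilbert (R : realType) (X : completeNormedModType R) : Prop :=
  exists ip : {dot X for (@idfun R)}, forall x : X, `|x| ^+ 2 = ip x x.

Definition dim_ge2 (R : realType) (X : lmodType R) : Prop :=
  exists x y : X, forall a b : R, a *: x + b *: y = 0 -> a = 0 /\ b = 0.

Definition unit_sphere (R : realType) (X : normedModType R) : set X :=
  [set x : X | `|x| = 1].

Definition birkhoff_orth (R : realType) (X : normedModType R) (x y : X) : Prop :=
  forall lambda : R, `|x| <= `|x + lambda *: y|.

Definition H_term (R : realType) (X : normedModType R) (nu : R) (x y : X) : R :=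
  (`|x + y| `^ nu * `|x - y| `^ (1 - nu)
   + `|x + y| `^ (1 - nu) * `|x - y| `^ nu) / 2.

(* The real-valued [sup] is a junk value (0) on a set that is empty or not
   bounded above; the set below is nonempty as soon as [dim_ge2 X], and it is
   bounded above by 2 for 0 <= nu <= 1. *)
Definition H_const (R : realType) (X : normedModType R) (nu : R) : R :=
  sup [set r : R | exists x y : X,
         [/\ unit_sphere x, unit_sphere y, birkhoff_orth x y
           & r = H_term nu x y]].

(* Main.v *)
(** In an inner product space, Birkhoff orthogonality is orthogonality for the
    inner product, so two Birkhoff orthogonal unit vectors [x], [y] satisfy
    [|x + y| = |x - y| = sqrt 2] by Pythagoras.  Every term of the supremum is
    then [sqrt 2], whatever [nu] is, and Gram-Schmidt shows that the supremum
    is taken over a nonempty set. *)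
Require Import Defs.
From HB Require Import structures.
From mathcomp Require Import all_boot all_order all_algebra.
From mathcomp Require Import all_classical all_reals all_analysis.
From mathcomp Require Import ring lra.
Import Order.TTheory GRing.Theory Num.Theory.
Import numFieldNormedType.Exports.
Local Open Scope classical_set_scope.
Local Open Scope ring_scope.

Lemma sqnormDZ {R : realType} {X : normedModType R}
    {ip : {dot X for (@idfun R)}} (ipE : forall x : X, `|x| ^+ 2 = ip x x)
    (x y : X) (a : R) :
  `|x + a *: y| ^+ 2 = `|x| ^+ 2 + 2 * a * ip x y + a ^+ 2 * `|y| ^+ 2.
Proof.
rewrite !ipE hnormD !linearZr_LR linearZl_LR /= expr0 mul1r [_ *: _]mulrC; ring.
Qed.

(** In [a], [|x + a *: y| ^+ 2] is a quadratic polynomial with linear coefficient [2 * ip x y]; it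
    is minimal at 0 exactly when that coefficient vanishes. *)
Lemma birkhoff_orthP {R : realType} {X : normedModType R}
    {ip : {dot X for (@idfun R)}} (ipE : forall x : X, `|x| ^+ 2 = ip x x)
    (x y : X) :
  birkhoff_orth x y <-> ip x y = 0.
Proof.
split=> [xy|xy0 a].
- have [->|y0] := eqVneq y 0; first by rewrite linear0r.
  have yy : 0 < `|y| ^+ 2 by rewrite exprn_gt0 // normr_gt0.
  (* This multiple of [y] is the one that minimises [|x + a *: y|]. *)
  have := xy (- (ip x y / `|y| ^+ 2)).
  rewrite -(ler_pXn2r (ltn0Sn 1)) ?nnegrE ?normr_ge0//.
  rewrite (sqnormDZ ipE).
  set c := ip x y; set s := `|y| ^+ 2 in yy *; set n := `|x| ^+ 2.
  have -> : n + 2 * - (c / s) * c + (- (c / s)) ^+ 2 * s = n - c ^+ 2 / s.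
    by field; rewrite gt_eqF.
  rewrite lerBrDr gerDl pmulr_lle0 ?invr_gt0// => c2.
  by apply/eqP; rewrite -sqrf_eq0 eq_le c2 sqr_ge0.
- rewrite -(ler_pXn2r (ltn0Sn 1)) ?nnegrE ?normr_ge0//.
  by rewrite (sqnormDZ ipE) xy0 mulr0 addr0 lerDl mulr_ge0 ?sqr_ge0.
Qed.

Lemma exists_orthonormal_pair {R : realType} {X : normedModType R}
    {ip : {dot X for (@idfun R)}} (ipE : forall x : X, `|x| ^+ 2 = ip x x)
    (hdim : dim_ge2 X) :
  exists x y : X, [/\ `|x| = 1, `|y| = 1 & ip x y = 0].
Proof.
have [x [y xyfree]] := hdim.
have x0 : x != 0.
  apply/eqP => x0; have := xyfree 1 0.
  by rewrite x0 scaler0 scale0r addr0 => /(_ erefl)[/eqP]; rewrite oner_eq0.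
(* Gram-Schmidt: [y] minus its projection on [x]. The factor [1] keeps the shape of [xyfree], which
   then gives [w != 0]. *)
pose w := - (ip x y / ip x x) *: x + 1 *: y.
have w0 : w != 0 by apply/eqP => /xyfree[_ /eqP]; rewrite oner_eq0.
have xw : ip x w = 0.
  rewrite /w scale1r linearDr linearZr_LR /= mulNr divfK ?addNr//.
  by rewrite gt_eqF// neq0_dnorm_gt0.
have norm1 (v : X) : v != 0 -> `| `|v|^-1 *: v| = 1.
  by move=> v0; rewrite normrZ normfV normr_id mulVf// normr_eq0.
exists (`|x|^-1 *: x), (`|w|^-1 *: w); split; [exact: norm1..|].
by rewrite linearZl_LR linearZr_LR /= xw !mulr0.
Qed.

Lemma H_term_orthonormal {R : realType} {X : normedModType R}
    {ip : {dot X for (@idfun R)}} (ipE : forall x : X, `|x| ^+ 2 = ip x x)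
    (nu : R) (x y : X) :
  `|x| = 1 -> `|y| = 1 -> ip x y = 0 -> H_term nu x y = Num.sqrt 2.
Proof.
move=> x1 y1 xy0.
(* Pythagoras for [x + y] and [x - y] at once, with [a] equal to 1 or -1. *)
have norm2 (a : R) : a ^+ 2 = 1 -> `|x + a *: y| = Num.sqrt 2.
  move=> a1; rewrite -[LHS]normr_id -sqrtr_sqr.
  by rewrite (sqnormDZ ipE) x1 y1 xy0 a1; congr Num.sqrt; ring.
(* The exponents [nu] and [1 - nu] add up to 1, so [nu] disappears from both products. *)
have sqrt2M (s t : R) : s + t = 1 ->
    Num.sqrt 2 `^ s * Num.sqrt 2 `^ t = Num.sqrt 2 :> R.
  move=> st1; rewrite -powRD ?st1 ?powRr1 ?sqrtr_ge0//.
  by rewrite gt_eqF ?implybT// sqrtr_gt0.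
rewrite /H_term -[in x + y](scale1r y) -[in x - y]scaleN1r.
rewrite !norm2 ?sqrrN ?expr1n// !sqrt2M; [by field|ring|ring].
Qed.

Theorem proposition3p2 (R : realType) (X : completeNormedModType R)
    (hX : is_hilbert X) (hdim : dim_ge2 X) (nu : R)
    (hnu0 : 0 <= nu) (hnu1 : nu <= 1) :
  H_const X nu = Num.sqrt 2.
Proof.
have [ip ipE] := hX.
(* The set of terms is shown to be the singleton of [Num.sqrt 2]; the second inclusion needs an
   orthonormal pair. *)
rewrite -[RHS]sup1; congr sup; apply/seteqP; split=> r /=.
- move=> [x [y [x1 y1 /(birkhoff_orthP ipE) xy0 ->]]].
  exact: (H_term_orthonormal ipE).
- move=> ->; have [x [y [x1 y1 xy0]]] := exists_orthonormal_pair ipE hdim.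
  exists x, y; split=> //; first exact/(birkhoff_orthP ipE).
  by rewrite (H_term_orthonormal ipE).
Qed.
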